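(* Let $Q$ be the graph on the 13-element vertex set $\mathbb{Z}/13\mathbb{Z}$ in which two distinct vertices $x,y$ are adjacent if and only if $x-y\notin\{1,-1,5,-5\}$ modulo $13$. Let $G=K_8+Q$ be the join of the complete graph $K_8$ on 8 vertices and $Q$. Then $G\stackrel{e}{\to}(3,5)$; that is, for every partition $E(G)=E_1\cup E_2$, $E_1\cap E_2=\emptyset$, of the edge set of $G$ into two colors, there is either a 3-clique of $G$ all of whose edges lie in $E_1$ or a 5-clique of $G$ all of whose edges lie in $E_2$.
   Context: All graphs are finite, undirected, without loops or multiple edges. A $p$-clique of a graph is a set of $p$ pairwise adjacent vertices. For graphs $G_1,G_2$ without common vertices, the join $G_1+G_2$ is the graph with vertex set $V(G_1)\cup V(G_2)$ and edge set $E(G_1)\cup E(G_2)\cup\{[x,y]:x\in V(G_1),\,y\in V(G_2)\}$. The symbol $G\stackrel{e}{\to}(a_1,\ldots,a_r)$ means that in every $r$-coloring of $E(G)$ there is, for some $i\in\{1,\ldots,r\}$, an $a_i$-clique all of whose edges have color $i$. The graph $Q$ is the complement of the 13-vertex Greenwood–Gleason graph (the circulant graph on $\mathbb{Z}/13\mathbb{Z}$ with connection set $\{\pm1,\pm5\}$, which shows $R(3,5)>13$); $Q$ has clique number 4 and independence number 2. *)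

(* Defs.v *)
From mathcomp Require Import all_boot all_algebra.
Set Implicit Arguments.
Unset Strict Implicit.
Unset Printing Implicit Defensive.

Import GRing.Theory.

Record sgraph := SGraph {
  vertex :> finType;
  adj : rel vertex;
  adj_sym : symmetric adj;
  adj_irrefl : irreflexive adj }.

Definition edges (G : sgraph) : {set {set G}} :=
  [set e : {set G} | [exists x, exists y, adj x y && (e == [set x; y])]].

Definition clique (G : sgraph) (p : nat) (S : {set G}) : Prop :=
  #|S| = p /\ {in S &, forall x y, x != y -> adj x y}.

Definition edge (G : sgraph) : Type := {e : {set G} | e \in edges G}.

(* The edges of a clique [S] are the edges of [G] contained in [S]. *)
Definition arrows (G : sgraph) (r : nat) (a : r.-tuple nat) : Prop :=
  forall c : edge G -> 'I_r,
  exists (i : 'I_r) (S : {set G}),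
    clique (tnth a i) S /\ (forall e : edge G, sval e \subset S -> c e = i).

Section Complete.
Variable n : nat.

Definition complete_rel (x y : 'I_n) : bool := x != y.

Lemma complete_sym : symmetric complete_rel.
Proof. by move=> x y; rewrite /complete_rel eq_sym. Qed.

Lemma complete_irrefl : irreflexive complete_rel.
Proof. by move=> x; rewrite /complete_rel eqxx. Qed.

Definition complete : sgraph := SGraph complete_sym complete_irrefl.
End Complete.

Section Join.
Variables G1 G2 : sgraph.

Definition join_rel (u v : G1 + G2) : bool :=
  match u, v with
  | inl x, inl y => adj x y
  | inr x, inr y => adj x y
  | _, _ => true
  end.

Lemma join_sym : symmetric join_rel.
Proof. by move=> [x|x] [y|y] //=; apply: adj_sym. Qed.

Lemma join_irrefl : irreflexive join_rel.
Proof. by move=> [x|x] /=; apply: adj_irrefl. Qed.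

Definition join : sgraph := SGraph join_sym join_irrefl.
End Join.

Definition Q_rel (x y : 'Z_13) : bool :=
  ((x != y) && (x - y \notin [:: 1; -1; 5%:R; - 5%:R]))%R.

Lemma Q_sym : symmetric Q_rel.
Proof.
move=> x y; rewrite /Q_rel eq_sym -(opprB y x) !inE !eqr_oppLR !opprK.
by congr (_ && ~~ _); do 4!case: (_ == _).
Qed.

Lemma Q_irrefl : irreflexive Q_rel.
Proof. by move=> x; rewrite /Q_rel eqxx. Qed.

Definition Q : sgraph := SGraph Q_sym Q_irrefl.

Definition K8Q : sgraph := join (complete 8) Q.

(* Main.v *)
(** Suppose the edges of [K8 + Q] are coloured with neither a red triangle nor
    a blue 5-clique.  For every vertex, the red neighbours span no 5-clique
    (its edges would all be blue), and the blue neighbours span no 9-clique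
    since [R(3,4) = 9].  A vertex [a] of [K8] with [d] red neighbours in [K8]
    thus splits [Q] into a part of clique number at most [4 - d] and one of
    clique number at most [1 + d].  Since every bipartition of [Q] has a
    3-clique in its first or a 4-clique in its second part, [d] is neither 1
    nor 2.  If [d = 0], the other seven vertices of [K8] all have exactly three
    red neighbours among themselves, against parity.  So [d >= 3] throughout,
    the red neighbourhood in [Q] of each vertex of [K8] is independent, and
    [K8] contains a blue triangle [S].  The common blue neighbours of [S] in
    [Q] contain no triangle, hence the rest of [Q] has a 4-clique; but it is
    covered by three independent sets. *)

Require Import Defs.
From mathcomp Require Import all_boot.
From mathcomp Require Import all_algebra zify.
Set Implicit Arguments.
Unset Strict Implicit.
Unset Printing Implicit Defensive.

(** * Cliques of a relation inside a vertex set, and parity of degree sums *)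

Section SubClique.
Variable T : finType.
Implicit Types (r : rel T) (S A B C : {set T}).

Definition is_clique r S := [forall x in S, forall y in S, (x != y) ==> r x y].

Lemma is_cliqueP r S :
  reflect {in S &, forall x y, x != y -> r x y} (is_clique r S).
Proof.
apply: (iffP forall_inP) => [clS x y Sx Sy neq_xy | clS x Sx].
  by move/forall_inP: (clS x Sx) => /(_ y Sy) /implyP; apply.
by apply/forall_inP => y Sy; apply/implyP; apply: clS.
Qed.

Definition has_clique r n A :=
  [exists S : {set T}, [&& S \subset A, #|S| == n & is_clique r S]].

Lemma has_cliqueP r n A :
  reflect (exists S, [/\ S \subset A, #|S| = n & is_clique r S])
          (has_clique r n A).
Proof.
apply: (iffP existsP) => [[S /and3P[SA /eqP nS clS]] | [S [SA nS clS]]].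
  by exists S.
by exists S; rewrite SA nS eqxx.
Qed.

Lemma is_cliqueS r A B : A \subset B -> is_clique r B -> is_clique r A.
Proof.
move=> /subsetP sAB /is_cliqueP clB; apply/is_cliqueP => x y Ax Ay.
by apply: clB; apply: sAB.
Qed.

Lemma is_clique_has r n S A :
  S \subset A -> n <= #|S| -> is_clique r S -> has_clique r n A.
Proof.
move=> sSA /card_geqP[s [us <- sS]] clS; apply/has_cliqueP.
have sS' : [set x in s] \subset S by apply/subsetP => x; rewrite inE; apply: sS.
exists [set x in s]; split; first exact: subset_trans sSA.
  by rewrite cardsE; apply/card_uniqP.
exact: is_cliqueS clS.
Qed.

Lemma has_cliqueS r n A B : A \subset B -> has_clique r n A -> has_clique r n B.
Proof.
move=> sAB /has_cliqueP[S [sSA <- clS]].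
by apply: is_clique_has clS => //; apply: subset_trans sAB.
Qed.

Lemma has_clique_leq r m n A : m <= n -> has_clique r n A -> has_clique r m A.
Proof.
by move=> le_mn /has_cliqueP[S [sSA nS clS]]; apply: is_clique_has clS; rewrite ?nS.
Qed.

Lemma has_cliqueU r m n A B C : symmetric r -> irreflexive r ->
    A \subset C -> B \subset C -> {in A & B, forall x y, r x y} ->
  has_clique r m A -> has_clique r n B -> has_clique r (m + n) C.
Proof.
move=> r_sym r_irr sAC sBC rAB /has_cliqueP[S [sSA nS clS]].
case/has_cliqueP=> [U [sUB nU clU]].
have rSU x y : x \in S -> y \in U -> r x y.
  by move=> Sx Uy; apply: rAB; [apply: (subsetP sSA) | apply: (subsetP sUB)].
apply/has_cliqueP; exists (S :|: U); split.
- by rewrite subUset (subset_trans sSA) ?(subset_trans sUB).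
(* A common vertex of [S] and [U] would carry a loop. *)
- rewrite cardsU nS nU; suff /eqP-> : S :&: U == set0 by rewrite cards0 subn0.
  by apply/set0Pn => -[x /setIP[Sx Ux]]; have := rSU x x Sx Ux; rewrite r_irr.
apply/is_cliqueP => x y /setUP[] xS /setUP[] yS neq_xy.
- exact: (is_cliqueP _ _ clS).
- exact: rSU.
- by rewrite r_sym; apply: rSU.
exact: (is_cliqueP _ _ clU).
Qed.

Lemma has_clique1 r n x A B : symmetric r -> irreflexive r ->
    x \in B -> A \subset B -> {in A, forall y, r x y} ->
  has_clique r n A -> has_clique r n.+1 B.
Proof.
move=> r_sym r_irr Bx sAB rxA.
apply: (@has_cliqueU r 1 n [set x]) => //; first by rewrite sub1set.
  by move=> _ y /set1P-> /rxA.
apply: is_clique_has (subxx _) _ _; rewrite ?cards1 //.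
by apply/is_cliqueP => y z /set1P-> /set1P->; rewrite eqxx.
Qed.

Definition nbr r x := [set y | r x y].

(** Induction on the list of vertices: a new vertex adds its row and its column to the double sum,
    equal by symmetry, and a diagonal term that vanishes. *)
Lemma handshake r S : symmetric r -> irreflexive r ->
  ~~ odd (\sum_(x in S) #|S :&: nbr r x|).
Proof.
move=> r_sym r_irr.
have -> : \sum_(x in S) #|S :&: nbr r x| =
          \sum_(x <- enum S) \sum_(y <- enum S) r x y.
  rewrite big_enum; apply: eq_bigr => x _; rewrite big_enum -sum1dep_card.
  by rewrite big_mkcondr; apply: eq_bigr => y _; rewrite inE; case: (r x y).
elim: (enum S) => [|x s IHs]; first by rewrite big_nil.
rewrite big_cons big_cons r_irr add0n.
under [X in _ + X]eq_bigr => y _ do rewrite big_cons r_sym.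
by rewrite big_split addnA addnn oddD odd_double.
Qed.

End SubClique.

(** * Two-colour Ramsey bounds up to R(3,4) <= 9 *)

Section Ramsey.
Variables (T : finType) (red blue : rel T).
Hypotheses (red_sym : symmetric red) (red_irr : irreflexive red).
Hypotheses (blue_sym : symmetric blue) (blue_irr : irreflexive blue).
Implicit Types (A S : {set T}).

Local Notation adj := (relU red blue).

(** The bound R(m,n) <= N for this one pair of colours, over cliques of [adj], so that it applies
    inside a graph that is not complete. *)
Definition ramsey m n N := forall S, is_clique adj S -> N <= #|S| ->
  has_clique red m S || has_clique blue n S.

Lemma leq_card_nbr S x : is_clique adj S -> x \in S ->
  #|S| <= (#|S :&: nbr red x| + #|S :&: nbr blue x|).+1.
Proof.
move=> clS Sx; rewrite (cardsD1 x) Sx add1n ltnS -cardsUI.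
apply: leq_trans (leq_addr _ _); apply/subset_leq_card/subsetP => y.
rewrite !inE => /andP[neq_yx Sy]; rewrite Sy !andTb.
by apply: (is_cliqueP _ _ clS) => //; rewrite eq_sym.
Qed.

Lemma ramsey_red_nbr m n p S x : ramsey m n p -> is_clique adj S -> x \in S ->
  p <= #|S :&: nbr red x| -> has_clique red m.+1 S || has_clique blue n S.
Proof.
move=> Rp clS Sx le_p; have sSnS : S :&: nbr red x \subset S by apply: subsetIl.
case/orP: (Rp _ (is_cliqueS sSnS clS) le_p) => clq; apply/orP; [left|right].
  by apply: (has_clique1 red_sym red_irr Sx sSnS _ clq) => y; rewrite !inE => /andP[].
exact: has_cliqueS clq.
Qed.

Lemma ramsey_blue_nbr m n q S x : ramsey m n q -> is_clique adj S -> x \in S ->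
  q <= #|S :&: nbr blue x| -> has_clique red m S || has_clique blue n.+1 S.
Proof.
move=> Rp clS Sx le_p; have sSnS : S :&: nbr blue x \subset S by apply: subsetIl.
case/orP: (Rp _ (is_cliqueS sSnS clS) le_p) => clq; apply/orP; [left|right].
  exact: has_cliqueS clq.
by apply: (has_clique1 blue_sym blue_irr Sx sSnS _ clq) => y; rewrite !inE => /andP[].
Qed.

(** The Erdos-Szekeres recursion: a vertex with fewer than [p] red and fewer than [q] blue
    neighbours in [S] would force [#|S| < p + q]. *)
Lemma ramseyS m n p q : 0 < p ->
  ramsey m n.+1 p -> ramsey m.+1 n q -> ramsey m.+1 n.+1 (p + q).
Proof.
move=> p_gt0 Rp Rq S clS le_pq.
have /card_gt0P[x Sx] : 0 < #|S| by lia.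
have := leq_card_nbr clS Sx.
have [le_p _ | lt_p] := leqP p #|S :&: nbr red x|.
  exact: ramsey_red_nbr Rp clS Sx le_p.
have [le_q _ | lt_q] := leqP q #|S :&: nbr blue x|.
  exact: ramsey_blue_nbr Rq clS Sx le_q.
lia.
Qed.

(* If both bounds are even, an extremal colouring would be red-regular of odd
   degree on an odd number of vertices. *)
Lemma ramseyS_even m n p q : 0 < p -> ~~ odd p -> ~~ odd q ->
  ramsey m n.+1 p -> ramsey m.+1 n q -> ramsey m.+1 n.+1 (p + q).-1.
Proof.
move=> p_gt0 even_p even_q Rp Rq S0 clS0 /card_geqP[s [us sz_s sS0]].
(* The parity argument needs an exact size. On p + q - 1 vertices, red degrees below [p] and blue
   degrees below [q] leave only p - 1 for the red degree. *)
pose S := [set x in s].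
have sS : S \subset S0 by apply/subsetP => x; rewrite inE; apply: sS0.
have nS : #|S| = (p + q).-1 by rewrite cardsE -sz_s; apply/card_uniqP.
have clS := is_cliqueS sS clS0.
suff /orP[] : has_clique red m.+1 S || has_clique blue n.+1 S.
- by move/(has_cliqueS sS)->.
- by move/(has_cliqueS sS)->; rewrite orbT.
apply: contraT => noS.
have deg x : x \in S -> #|S :&: nbr red x| = p.-1.
  move=> Sx; have := leq_card_nbr clS Sx.
  have [le_p _ | lt_p] := leqP p #|S :&: nbr red x|.
    by case/negP: noS; apply: ramsey_red_nbr Rp clS Sx le_p.
  have [le_q _ | lt_q] := leqP q #|S :&: nbr blue x|.
    by case/negP: noS; apply: ramsey_blue_nbr Rq clS Sx le_q.
  lia.
have := handshake S red_sym red_irr.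
rewrite (eq_bigr _ deg) sum_nat_const nS oddM; lia.
Qed.

Lemma ramsey1n n : ramsey 1 n 1.
Proof.
move=> S _ /card_gt0P[x Sx]; apply/orP; left.
apply: (@is_clique_has _ _ _ [set x]); rewrite ?sub1set ?cards1 //.
by apply/is_cliqueP => y z /set1P-> /set1P->; rewrite eqxx.
Qed.

Lemma ramseyn1 m : ramsey m 1 1.
Proof.
move=> S _ /card_gt0P[x Sx]; apply/orP; right.
apply: (@is_clique_has _ _ _ [set x]); rewrite ?sub1set ?cards1 //.
by apply/is_cliqueP => y z /set1P-> /set1P->; rewrite eqxx.
Qed.

Lemma ramsey2n n : ramsey 2 n.+1 n.+1.
Proof.
elim: n => [|n IHn]; first exact: ramseyn1.
exact: (@ramseyS 1 n.+1 1 n.+1 isT (ramsey1n _) IHn).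
Qed.

Lemma ramsey32 : ramsey 3 2 3.
Proof. exact: (@ramseyS 2 1 2 1 isT (@ramsey2n 1) (ramseyn1 _)). Qed.

Lemma ramsey33 : ramsey 3 3 6.
Proof. exact: (@ramseyS 2 2 3 3 isT (@ramsey2n 2) ramsey32). Qed.

(** The bounds 4 for R(2,4) and 6 for R(3,3) are both even, which saves one over their sum. *)
Lemma ramsey34 : ramsey 3 4 9.
Proof. exact: (@ramseyS_even 2 3 4 6 isT isT isT (@ramsey2n 3) ramsey33). Qed.

End Ramsey.

(** * The contradiction for an 8-clique [A] joined to a graph with property [vertex34] *)

Section Core.
Variables (T : finType) (red blue : rel T).
Hypotheses (red_sym : symmetric red) (red_irr : irreflexive red).
Hypotheses (blue_sym : symmetric blue) (blue_irr : irreflexive blue).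

Implicit Types (S : {set T}).

Local Notation adj := (relU red blue).

Variable A : {set T}.
Hypotheses (clA : is_clique adj A) (cardA : #|A| = 8).
Hypothesis joinA : forall x y, x \in A -> y \notin A -> adj x y.
Hypothesis vertex34 : forall U W : {set T}, ~: A \subset U :|: W ->
  has_clique adj 3 U || has_clique adj 4 W.
Hypotheses (no_red3 : ~~ has_clique red 3 setT).
Hypotheses (no_blue5 : ~~ has_clique blue 5 setT).

Let adj_sym : symmetric adj.
Proof. by move=> x y; rewrite /= red_sym blue_sym. Qed.

Let adj_irr : irreflexive adj.
Proof. by move=> x; rewrite /= red_irr blue_irr. Qed.

Let no_red3S S : has_clique red 3 S = false.
Proof. by apply: contraNF no_red3; apply: has_cliqueS (subsetT S). Qed.

Let no_red2 x S : {in S, forall y, red x y} -> has_clique red 2 S = false.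
Proof.
move=> red_xS; apply: contraNF no_red3.
exact: has_clique1 red_sym red_irr (in_setT x) (subsetT S) red_xS.
Qed.

Let no_blue4 x S : {in S, forall y, blue x y} -> has_clique blue 4 S = false.
Proof.
move=> blue_xS; apply: contraNF no_blue5.
exact: has_clique1 blue_sym blue_irr (in_setT x) (subsetT S) blue_xS.
Qed.

(** A red edge inside a red neighbourhood would close a red triangle. *)
Lemma blue_in_red_nbr x S n : S \subset nbr red x ->
  has_clique adj n.+1 S -> has_clique blue n.+1 S.
Proof.
move=> sS /has_cliqueP[U [sUS nU clU]].
have := ramsey2n red_sym red_irr blue_sym blue_irr clU (eq_leq (esym nU)).
rewrite (@no_red2 x); first exact: has_cliqueS.
by move=> y /(subsetP sUS) /(subsetP sS); rewrite inE.
Qed.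

Lemma clique_red_nbr_le4 x n : has_clique adj n (nbr red x) -> n <= 4.
Proof.
move=> clq; rewrite leqNgt; apply: contra no_blue5 => lt4n.
apply: has_cliqueS (subsetT (nbr red x)) _.
exact: blue_in_red_nbr (subxx _) (has_clique_leq lt4n clq).
Qed.

Lemma clique_blue_nbr_le8 x n : has_clique adj n (nbr blue x) -> n <= 8.
Proof.
move=> clq; rewrite leqNgt; apply/negP => lt8n.
have /has_cliqueP[U [/subsetP sU nU clU]] := has_clique_leq lt8n clq.
have := ramsey34 red_sym red_irr blue_sym blue_irr clU (eq_leq (esym nU)).
by rewrite no_red3S (@no_blue4 x) // => y /sU; rewrite inE.
Qed.

Lemma is_clique_A_nbr r x : is_clique adj (A :&: nbr r x).
Proof. by apply: is_cliqueS clA; apply: subsetIl. Qed.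

(** The neighbours in [A] form a clique joined to those outside, so sizes add. Bounds on a whole
    neighbourhood thus become bounds on its part outside [A]. *)
Lemma has_clique_nbrU (r : rel T) x n : has_clique adj n (nbr r x :\: A) ->
  has_clique adj (#|A :&: nbr r x| + n) (nbr r x).
Proof.
apply: has_cliqueU adj_sym adj_irr (subsetIr A _) (subsetDl _ A) _ _.
  by move=> y z /setIP[Ay _] /setDP[_ nAz]; apply: joinA.
exact: is_clique_has (subxx _) (leqnn _) (is_clique_A_nbr _ _).
Qed.

(** Let d be the red degree in [A]; the blue one is at least 7 - d. The split with red first gives d
    <= 1 or d >= 3; with blue first it gives d >= 2 or d = 0. *)
Lemma red_degree a : a \in A -> #|A :&: nbr red a| = 0 \/ 3 <= #|A :&: nbr red a|.
Proof.
move=> Aa; have := leq_card_nbr clA Aa; rewrite cardA => le_deg.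
have cov : ~: A \subset (nbr red a :\: A) :|: (nbr blue a :\: A).
  apply/subsetP => y; rewrite !inE => nAy; rewrite nAy /=.
  exact: joinA Aa nAy.
have cov' := cov; rewrite setUC in cov'.
by case/orP: (vertex34 cov) => /has_clique_nbrU;
  [move/clique_red_nbr_le4 | move/clique_blue_nbr_le8] => ?;
  case/orP: (vertex34 cov') => /has_clique_nbrU;
  [move/clique_blue_nbr_le8 | move/clique_red_nbr_le4 |
   move/clique_blue_nbr_le8 | move/clique_red_nbr_le4] => ?; lia.
Qed.

(** If [a] had red degree 0, the red graph on the other seven vertices would be 3-regular, with the
    odd degree sum 21. *)
Lemma red_degree_gt0 a : a \in A -> 3 <= #|A :&: nbr red a|.
Proof.
move=> Aa; case: (red_degree Aa) => // /eqP; rewrite cards_eq0 => /eqP deg0.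
pose A' := A :\ a.
have cardA' : #|A'| = 7 by have := cardsD1 a A; rewrite Aa cardA => -[].
have not_red_a y : y \in A -> red a y = false.
  move=> Ay; have /setP/(_ y) := deg0; rewrite !inE Ay; exact: id.
have blue_a y : y \in A' -> blue a y.
  case/setD1P=> neq_ya Ay; have := is_cliqueP _ _ clA a y Aa Ay.
  by rewrite /= not_red_a // eq_sym neq_ya; apply.
have deg b : b \in A' -> #|A' :&: nbr red b| = 3.
  move=> A'b; have /setD1P[neq_ba Ab] := A'b.
  have <- : A :&: nbr red b = A' :&: nbr red b.
    apply/setP => y; rewrite !inE; case: eqP => // ->.
    by rewrite red_sym not_red_a ?andbF.
  (* Four red neighbours of [b] in [A] would form a blue 4-clique, and all of them are blue
     neighbours of [a]. *)
  have le3 : #|A :&: nbr red b| <= 3.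
    rewrite leqNgt; apply/negP => lt3.
    have clq := is_clique_has (subxx _) lt3 (is_clique_A_nbr red b).
    have := blue_in_red_nbr (subsetIr _ _) clq; rewrite (@no_blue4 a) //.
    move=> y /setIP[Ay]; rewrite inE => red_by; apply: blue_a.
    rewrite !inE Ay andbT; apply: contraTneq red_by => ->.
    by rewrite red_sym not_red_a.
  case: (red_degree Ab) => [/eqP|ge3]; last by apply/eqP; rewrite eqn_leq le3.
  rewrite cards_eq0 => /eqP degb0; exfalso.
  pose B := A' :\ b.
  have cardB : #|B| = 6 by have := cardsD1 b A'; rewrite A'b cardA' => -[].
  have sBA : B \subset A by rewrite !(subset_trans (subD1set _ _)).
  (* If [b] also had red degree 0, a blue triangle among the six remaining vertices would extend by
     [b] and then by [a] to a blue 5-clique. *)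
  have := ramsey33 red_sym red_irr blue_sym blue_irr (is_cliqueS sBA clA).
  rewrite cardB no_red3S /= => /(_ isT) clq.
  suff: has_clique blue 4 A' by rewrite (no_blue4 blue_a).
    apply: (has_clique1 blue_sym blue_irr A'b (subD1set _ _) _ clq) => y.
    case/setD1P=> neq_yb A'y; have /setD1P[_ Ay] := A'y.
    have := is_cliqueP _ _ clA b y Ab Ay.
    have /setP/(_ y) := degb0; rewrite !inE Ay /= => ->.
    by rewrite eq_sym neq_yb; apply.
have := handshake A' red_sym red_irr.
by rewrite (eq_bigr _ deg) sum_nat_const cardA'.
Qed.

Lemma core_contradiction : False.
Proof.
have /card_gt0P[a Aa] : 0 < #|A| by rewrite cardA.
have /(blue_in_red_nbr (subsetIr _ _))/has_cliqueP[S [sSA nS clS]] :=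
  is_clique_has (subxx _) (red_degree_gt0 Aa) (is_clique_A_nbr red a).
have {}sSA : {subset S <= A} by move=> x /(subsetP sSA) /setIP[].
pose M := [set y | [forall x in S, blue x y]].
pose N := [set y | (y \notin A) && [exists x in S, red x y]].
have cov : ~: A \subset M :|: N.
  apply/subsetP => y; rewrite !inE => nAy; rewrite nAy /=.
  rewrite orbC -implyNb negb_exists_in; apply/implyP => /forall_inP not_red.
  apply/forall_inP => x Sx; have := joinA (sSA x Sx) nAy.
  by rewrite /= (negbTE (not_red x Sx)).
case/orP: (vertex34 cov) => /has_cliqueP[K [/subsetP sK nK clK]].
  (* A triangle in [M] has a blue edge, which together with [S] makes a blue 5-clique. *)
  have := ramsey32 red_sym red_irr blue_sym blue_irr clK (eq_leq (esym nK)).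
  rewrite no_red3S /= => clq.
  have clqS := is_clique_has (subxx _) (eq_leq (esym nS)) clS.
  case/negP: no_blue5.
  apply: has_cliqueU blue_sym blue_irr (subsetT _) (subsetT _) _ clqS clq.
  by move=> x y Sx Ky; have := sK y Ky; rewrite inE => /forall_inP; apply.
(* A red neighbour in [S]; the default [a] is never taken on [K]. Injectivity of [f] on [K] will
   embed four vertices into three. *)
pose f y := odflt a [pick x in S | red x y].
have fP y : y \in K -> (f y \in S) && red (f y) y.
  move=> Ky; rewrite /f; case: pickP => [//|no_x].
  have := sK y Ky; rewrite inE => /andP[_ /exists_inP[x Sx xy]].
  by have := no_x x; rewrite Sx xy.
have inj_f : {in K &, injective f}.
  move=> y z Ky Kz eq_f; apply/eqP; apply: contraT => neq_yz.
  have /andP[Sx red_y] := fP y Ky.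
  have /andP[_ red_z] := fP z Kz; rewrite -eq_f in red_z.
  (* An edge in the red neighbourhood outside [A], added to at least three red neighbours in [A],
     exceeds the bound 4. *)
  have : has_clique adj 2 (nbr red (f y) :\: A).
    apply: (@is_clique_has _ _ _ [set y; z]); rewrite ?cards2 ?neq_yz //.
      apply/subsetP => w /set2P[]->; rewrite !inE ?red_y ?red_z andbT;
      [have := sK y Ky | have := sK z Kz]; by rewrite inE => /andP[].
    by apply: is_cliqueS clK; apply/subsetP => w /set2P[]->.
  move/has_clique_nbrU/clique_red_nbr_le4.
  have := red_degree_gt0 (sSA _ Sx); lia.
have : #|f @: K| <= #|S|.
  by apply/subset_leq_card/subsetP => _ /imsetP[y Ky ->]; case/andP: (fP y Ky).
by rewrite card_in_imset // nK nS.
Qed.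

End Core.

Lemma has_clique_inj (T T' : finType) (e : rel T) (r : rel T') (f : T -> T')
    n (A : {set T}) (B : {set T'}) :
    injective f -> {homo f : x y / e x y >-> r x y} -> f @: A \subset B ->
  has_clique e n A -> has_clique r n B.
Proof.
move=> inj_f homo_f sAB /has_cliqueP[S [sSA <- clS]].
apply: (@is_clique_has _ _ _ (f @: S)).
- exact: subset_trans (imsetS f sSA) sAB.
- by rewrite card_imset.
apply/is_cliqueP => _ _ /imsetP[x Sx ->] /imsetP[y Sy ->].
by rewrite (inj_eq inj_f) => /(is_cliqueP _ _ clS x y Sx Sy) /homo_f.
Qed.

(** * Exhaustive search for vertex arrowing, and its run on [Q] *)

Section VertexArrow.
Variables (T : finType) (e : rel T).
Hypotheses (e_sym : symmetric e) (e_irr : irreflexive e).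

(** The clique is built in list order, each choice filtering the later vertices. The outer recursion
    is on [n] because a filtered list is not a structural subterm. *)
Fixpoint seq_clique n (s : seq T) : bool :=
  if n is n'.+1 then
    (fix aux s := if s is x :: s' then
       seq_clique n' [seq y <- s' | e x y] || aux s' else false) s
  else true.

(** A decision tree placing the vertices of [s] one by one on either side, pruned once a side
    contains the required clique. *)
Fixpoint vertex_arrows m n (s1 s2 s : seq T) : bool :=
  [|| seq_clique m s1, seq_clique n s2 |
      if s is x :: s' then vertex_arrows m n (x :: s1) s2 s' &&
                           vertex_arrows m n s1 (x :: s2) s'
      else false].

Lemma seq_clique_has n (s : seq T) (A : {set T}) :
  seq_clique n s -> {subset s <= A} -> has_clique e n A.
Proof.
elim: n s A => [|n IHn] s A.
  move=> _ _; apply: (@is_clique_has _ _ _ set0); rewrite ?sub0set //.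
  by apply/is_cliqueP => x y; rewrite inE.
elim: s A => [//|x s IHs] A /orP[clq | clq] sA; last first.
  by apply: (IHs _ clq) => y sy; apply: sA; rewrite inE sy orbT.
have Ax : x \in A by apply: sA; rewrite inE eqxx.
have := IHn _ [set y in [seq y <- s | e x y]] clq.
move=> /(_ (fun y => _)) clq'; apply: (has_clique1 e_sym e_irr Ax _ _ (clq' _)).
- apply/subsetP => y; rewrite inE mem_filter => /andP[_ sy].
  by apply: sA; rewrite inE sy orbT.
- by move=> y; rewrite inE mem_filter => /andP[].
by move=> y; rewrite inE.
Qed.

(** Soundness of the search: [U] and [W] trace a path in the tree, each vertex going to a set that
    contains it, and the path ends at a clique. *)
Lemma vertex_arrows_has m n (s1 s2 s : seq T) (U W : {set T}) :
    vertex_arrows m n s1 s2 s ->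
    {subset s1 <= U} -> {subset s2 <= W} -> {subset s <= U :|: W} ->
  has_clique e m U || has_clique e n W.
Proof.
elim: s s1 s2 => [|x s IHs] s1 s2 /=.
  rewrite orbF => /orP[] /seq_clique_has clq s1U s2W _.
    by rewrite clq.
  by rewrite (clq W) ?orbT.
case/or3P=> [/seq_clique_has clq s1U | /seq_clique_has clq _ s2W |].
- by rewrite clq.
- by rewrite (clq W) ?orbT.
case/andP=> arrU arrW s1U s2W sUW.
have sUW' : {subset s <= U :|: W} by move=> y sy; apply: sUW; rewrite inE sy orbT.
have /setUP[Ux|Wx] : x \in U :|: W by apply: sUW; rewrite inE eqxx.
  by apply: (IHs _ _ arrU) => // y; rewrite inE => /predU1P[->|/s1U].
by apply: (IHs _ _ arrW) => // y; rewrite inE => /predU1P[->|/s2W].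
Qed.

End VertexArrow.

(* Equals [Q_rel] on representatives below 13, but evaluates fast. *)
Definition Q_nat (i j : nat) := (i - j) + (j - i) \in [:: 2; 3; 4; 6; 7; 9; 10; 11].

Lemma Q_natE (x y : Q) : Q_nat x y = Q_rel x y.
Proof.
have: all (fun i => all (fun j => Q_nat i j == Q_rel (inZp i) (inZp j)) (iota 0 13))
          (iota 0 13) by [].
move=> /allP/(_ (val x)); rewrite mem_iota => /(_ (ltn_ord x)).
move=> /allP/(_ (val y)); rewrite mem_iota => /(_ (ltn_ord y)) /eqP->.
by rewrite !valZpK.
Qed.

(** Checked by evaluation; the tree has at most 2^13 leaves, and [Q_nat] avoids modular
    arithmetic. *)
Lemma Q_search : vertex_arrows (fun x y : Q => Q_nat x y) 3 4 [::] [::]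
  [seq inZp i | i <- iota 0 13].
Proof. by lazy. Qed.

Lemma Q_vertex_arrows (U W : {set Q}) : U :|: W = setT ->
  has_clique (@adj Q) 3 U || has_clique (@adj Q) 4 W.
Proof.
move=> covUW; pose e : rel Q := fun x y => Q_nat x y.
have eE : e =2 @adj Q by move=> x y; rewrite /e Q_natE.
have e_sym : symmetric e by move=> x y; rewrite !eE adj_sym.
have e_irr : irreflexive e by move=> x; rewrite eE adj_irrefl.
have homo_id : {homo id : x y / e x y >-> adj x y} by move=> x y; rewrite eE.
have e_adj n (X : {set Q}) : has_clique e n X -> has_clique (@adj Q) n X.
  by apply: has_clique_inj homo_id _ => //; rewrite imset_id.
have subUW (s : seq Q) : {subset s <= U :|: W} by move=> x _; rewrite covUW inE.
have sub0 (X : {set Q}) : {subset [::] <= X} by move=> x; rewrite in_nil.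
have := vertex_arrows_has e_sym e_irr Q_search (sub0 U) (sub0 W) (subUW _).
by case/orP=> /e_adj->; rewrite ?orbT.
Qed.

(** * Application to [K8Q], with [E] as the set of red edges *)

Section Coloring.
Variable E : {set {set K8Q}}.

Definition red (x y : K8Q) := adj x y && ([set x; y] \in E).
Definition blue (x y : K8Q) := adj x y && ([set x; y] \notin E).

Lemma red_or_blue x y : red x y || blue x y = adj x y.
Proof. by rewrite -andb_orr orbN andbT. Qed.

Lemma K8Q_clique : has_clique red 3 setT || has_clique blue 5 setT.
Proof.
have red_sym : symmetric red by move=> x y; rewrite /red adj_sym setUC.
have red_irr : irreflexive red by move=> x; rewrite /red adj_irrefl.
have blue_sym : symmetric blue by move=> x y; rewrite /blue adj_sym setUC.
have blue_irr : irreflexive blue by move=> x; rewrite /blue adj_irrefl.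
apply: contraT; rewrite negb_or => /andP[no_red no_blue].
pose A : {set K8Q} := [set inl i | i in [set: 'I_8]].
have memA (u : K8Q) : (u \in A) = if u is inl _ then true else false.
  by apply/imsetP; case: u => [i|i]; [exists i | case].
have homo_inr : {homo (inr : Q -> K8Q) : x y / adj x y >-> relU red blue x y}.
  by move=> x y; rewrite /= red_or_blue.
exfalso; apply: (core_contradiction red_sym red_irr blue_sym blue_irr (A := A)
  _ _ _ _ no_red no_blue).
- apply/is_cliqueP => [[x|x] [y|y]]; rewrite !memA // => _ _ neq.
  by rewrite /= red_or_blue.
- by rewrite card_imset ?cardsT ?card_ord // => x y [].
- by move=> [x|x] [y|y]; rewrite !memA //= red_or_blue.
(* The property [vertex34] is pulled back along [inr] to a cover of [Q]. *)
move=> U W /subsetP covUW; pose V (U : {set K8Q}) : {set Q} := inr @^-1: U.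
have sV X : inr @: V X \subset X.
  by apply/subsetP => _ /imsetP[x + ->]; rewrite inE.
have inr_inj : injective (inr : Q -> K8Q) by move=> x y [].
have /Q_vertex_arrows/orP[] : V U :|: V W = setT.
- apply/setP => x; have := covUW (inr x).
  by rewrite !inE memA => ->.
- by move/(has_clique_inj inr_inj homo_inr (sV U))->.
by move/(has_clique_inj inr_inj homo_inr (sV W))->; rewrite orbT.
Qed.

(** Passes from coloured pairs of vertices to edges as sets: an edge contained in a clique is a pair
    of distinct vertices of it, hence has the colour of the clique. *)
Lemma K8Q_colored_clique :
  (exists S : {set K8Q}, clique 3 S /\
     (forall e : {set K8Q}, e \in edges K8Q -> e \subset S -> e \in E)) \/
  (exists S : {set K8Q}, clique 5 S /\
     (forall e : {set K8Q}, e \in edges K8Q -> e \subset S -> e \notin E)).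
Proof.
have edge_in (r : rel K8Q) S (e : {set K8Q}) : is_clique r S ->
    e \in edges K8Q -> e \subset S -> exists x y, r x y /\ e = [set x; y].
  move=> clS; rewrite inE => /existsP[x /existsP[y /andP[xy /eqP->]]].
  rewrite subUset !sub1set => /andP[Sx Sy]; exists x, y; split=> //.
  by apply: (is_cliqueP _ _ clS) => //; apply: contraTneq xy => ->; rewrite adj_irrefl.
case/orP: K8Q_clique => /has_cliqueP[S [_ nS clS]]; [left | right];
  exists S; split=> [|e eE eS].
- by split=> // x y Sx Sy /(is_cliqueP _ _ clS x y Sx Sy) /andP[].
- by have [x [y [/andP[_ xyE] ->]]] := edge_in _ _ _ clS eE eS.
- by split=> // x y Sx Sy /(is_cliqueP _ _ clS x y Sx Sy) /andP[].
by have [x [y [/andP[_ xyE] ->]]] := edge_in _ _ _ clS eE eS.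
Qed.

End Coloring.

Theorem mainTheorem1 :
  arrows K8Q [tuple 3; 5] /\
  (forall E1 E2 : {set {set K8Q}},
     E1 :|: E2 = edges K8Q -> E1 :&: E2 = set0 ->
     (exists S : {set K8Q}, clique 3 S /\
        (forall e : {set K8Q}, e \in edges K8Q -> e \subset S -> e \in E1)) \/
     (exists S : {set K8Q}, clique 5 S /\
        (forall e : {set K8Q}, e \in edges K8Q -> e \subset S -> e \in E2))).
Proof.
split=> [c | E1 E2 E12 _].
  (* The class of the first colour, moved from the subtype of edges to sets of vertices. *)
  pose E : {set {set K8Q}} := [set sval e | e : {e | e \in edges K8Q} & c e == ord0].
  have memE (e : edge K8Q) : (sval e \in E) = (c e == ord0).
    apply/imsetP/idP => [[e' c_e' /val_inj->] | c_e]; first by rewrite inE in c_e'.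
    by exists e; rewrite ?inE.
  have [[S [clS mono]]|[S [clS mono]]] := K8Q_colored_clique E.
    exists ord0, S; split=> // e eS; apply/eqP.
    by rewrite -memE; apply: mono eS; apply: (svalP e).
  exists ord_max, S; split=> // e eS.
  have := mono _ (svalP e) eS; rewrite memE.
  (* In ['I_2] a colour other than [ord0] is [ord_max]. *)
  by case: (c e) => [[|[|]]] // lt _; apply: val_inj.
have [|[S [clS mono]]] := K8Q_colored_clique E1; first by left.
right; exists S; split=> // e eE eS; move: (mono e eE eS).
(* An edge outside [E1] lies in [E2], since the two classes cover all edges. *)
by move: eE; rewrite -E12 inE => /orP[->|].
Qed.
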